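(* Let $\mu$ be a probability measure on $\mathbb{R}$ and let $H_N$ be the real symmetric $N\times N$ Wigner matrix associated with $\mu$. Fix $p\ge1$ and $E\in\mathbb{R}$. If $\mu$ has infinite $(2p)$-th moment, then $$\mathbb{E}[|\det(H_N-E)|^p]=+\infty$$ for every finite $N$. On the other hand, if $\mu$ has finite $(2p)$-th moment, then $$\limsup_{N\to\infty}\frac1N\log\mathbb{E}[|\det(H_N-E)|^p]<\infty.$$
   Context: The Wigner matrix associated with $\mu$ is a real symmetric $N\times N$ random matrix $H_N$ such that the entries of $\sqrt N H_N$ are independent up to symmetry and each distributed according to $\mu$. There are no regularity assumptions on $\mu$ other than the moment ones stated. $H_N-E$ means $H_N-E\,\mathrm{Id}$. The $(2p)$-th moment of $\mu$ is $\int_{\mathbb{R}}|x|^{2p}\,\mu(dx)$.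
   Formalization: The first claim is stated for every N ≥ 2 rather than every finite N, because for N = 1 it fails: a measure with finite p-th but infinite 2p-th moment gives a finite expectation of |H_1 − E|^p. *)

(* Defs.v *)
From HB Require Import structures.
From mathcomp Require Import all_boot all_order all_algebra.
From mathcomp Require Import all_classical all_reals all_analysis.

Set Implicit Arguments.
Unset Strict Implicit.
Unset Printing Implicit Defensive.

Import Order.TTheory GRing.Theory Num.Theory.
Import numFieldNormedType.Exports.

Local Open Scope classical_set_scope.
Local Open Scope ring_scope.

Definition mutually_independent (R : realType) (d : measure_display)
    (T : measurableType d) (P : probability T R) (I : finType)
    (X : I -> T -> R) : Prop :=
  forall (J : {set I}) (B : I -> set R),
    (forall i, measurable (B i)) ->
    P (\bigcap_(i in [set` J]) X i @^-1` B i)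
      = (\prod_(i in J) P (X i @^-1` B i))%E.

(* The diagonal is included: diagonal and off-diagonal entries of a Wigner
   matrix have the same law here. *)
Definition upper_index (N : nat) : finType :=
  {ij : 'I_N * 'I_N | (ij.1 <= ij.2)%N}.

Definition scaled_entry (R : realType) (N : nat) (T : Type)
    (H : T -> 'M[R]_N) (i j : 'I_N) (w : T) : R :=
  Num.sqrt N%:R * H w i j.

(* The law is compared with mu on measurable sets only: measures of the library
   are total functions, unconstrained on non-measurable sets. *)
Definition wigner (R : realType) (mu : probability (measurableTypeR R) R)
    (N : nat) (d : measure_display) (T : measurableType d)
    (P : probability T R) (H : T -> 'M[R]_N) : Prop :=
  [/\ forall w, (H w)^T = H w,
      forall i j, measurable_fun setT (fun w => H w i j),
      mutually_independent P
        (fun k : upper_index N => scaled_entry H (val k).1 (val k).2)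
    & forall i j (A : set (measurableTypeR R)), measurable A ->
        P (scaled_entry H i j @^-1` A) = mu A].

Definition abs_moment (R : realType) (mu : probability (measurableTypeR R) R)
    (q : R) : \bar R :=
  (\int[mu]_x (`|x| `^ q)%R%:E)%E.

Definition det_moment (R : realType) (d : measure_display)
    (T : measurableType d) (P : probability T R) (N : nat)
    (H : T -> 'M[R]_N) (E p : R) : \bar R :=
  ('E_P[fun w => (`|\det (H w - E%:M)| `^ p)%R])%E.

(* Main.v *)
Require Import Defs.
From HB Require Import structures.
From mathcomp Require Import all_boot all_order all_algebra.
From mathcomp Require Import all_classical all_reals all_analysis.
From mathcomp Require Import perm finmap measurable_realfun.
From mathcomp Require Import ring lra.

Import Order.TTheory GRing.Theory Num.Theory.
Import numFieldNormedType.Exports.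
Import HBNNSimple.

Local Open Scope classical_set_scope.
Local Open Scope ring_scope.

(** Write [X i j] for the entries of [sqrt N * H]; they have law [mu].

    The off-diagonal variable [X 0 1] enters the determinant quadratically, and
    this alone makes the expectation infinite when [mu] has an infinite moment of
    order [2p].  Take [B] with [mu [-B, B] > 0] and [K] much larger than [B]; ask
    the entries at the positions [(i, s i)], with [s] the transposition of 0 and
    1, to be at least [K] in absolute value, and all the others to be at most
    [B].  On this event the term of [s] dominates the Leibniz formula, so
    [|det| >= c * X 0 1 ^ 2] ([sqr_le_det_of_swap]).  The event is a product of
    conditions on independent entries, each of positive probability because [mu]
    has unbounded support, so [E |det|^p >= const * E (c * X 0 1 ^ 2)^p = +oo],
    the last expectation being over the tail only ([det_moment_pinfty]).

    For the upper bound, Hadamard's inequality gives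
    [det ^ 2 <= \prod_i |row i| ^ 2] ([sqr_det_le_prod_row]).  Rows of a
    symmetric matrix are dependent, and [X i j] occurs in rows [i] and [j], so the
    product is split: [a + b <= (1 + a) (1 + b)] bounds it by [U * V], where
    [U] only uses the entries on and above the diagonal and [V] those on and below
    it ([sqr_det_le_row_means]).  Then [|det|^p <= max(U, V)^p <= U^p + V^p].
    Each of [U] and [V] is a product of row means in which no independent variable
    occurs in two rows; Jensen and the expansion of the product of sums over all
    maps [f : 'I_N -> 'I_N] leave products of independent variables, whose
    expectation is at most [m ^ N] ([expectation_row_means_le]), where [m] is
    finite by the moment condition and does not depend on [N].  Hence
    [E |det|^p <= 2 * m ^ N] ([det_moment_le]).

    Both halves use independence through one identity only: the expectation of a
    product of nonnegative functions of independent variables is the product of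
    the expectations, infinite values included ([expectation_prod_indep]). *)

(** * Determinant inequalities *)

(** In the Leibniz formula, the term of a permutation other than [s0] has a factor
    at most [M] where the term of [s0] has one at least [L], hence it is at most
    [M / L] times the latter; there are fewer than [n!] such terms. *)
Lemma det_perm_dominant {R : realFieldType} {n} (A : 'M[R]_n)
    (s0 : {perm 'I_n}) (M L : R) :
  0 <= M -> 0 < L -> 2 * n`!%:R * M <= L ->
  (forall i, L <= `|A i (s0 i)|) ->
  (forall i j, j != s0 i -> `|A i j| <= M) ->
  \prod_i `|A i (s0 i)| <= 2 * `|\det A|.
Proof.
move=> M0 L0 ML big small.
set D := \prod_i `|A i (s0 i)|.
have D0 : 0 <= D by apply: prodr_ge0.
have f1 : (1 : R) <= n`!%:R by rewrite ler1n fact_gt0.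
have MleL : M <= L by apply: le_trans ML; nra.
have termE (s : {perm 'I_n}) : `|(-1) ^+ s * \prod_i A i (s i)| = \prod_i `|A i (s i)|.
  by rewrite normrM normrX normrN1 expr1n mul1r normr_prod.
have le_term (s : {perm 'I_n}) : s != s0 -> \prod_i `|A i (s i)| <= M / L * D.
  move=> ss0.
  (* Row [i], where the two permutations differ, provides the factor M / L. *)
  have [i si] : exists i, s i != s0 i.
    apply/existsP; apply: contraNT ss0; rewrite negb_exists => /forallP h.
    by apply/eqP/permP => i; have := h i; rewrite negbK => /eqP.
  rewrite /D (bigD1 i) //= [X in _ <= _ * X](bigD1 i) //= mulrA.
  apply: ler_pM => //; first exact: prodr_ge0.
    apply: (le_trans (small _ _ si)).
    by rewrite mulrAC ler_pdivlMr // ler_wpM2l.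
  apply: ler_prod => j _; rewrite normr_ge0 /=.
  have [->//|sj] := eqVneq (s j) (s0 j).
  by rewrite (le_trans (small _ _ sj)) // (le_trans MleL).
have rest : `|\sum_(s : {perm 'I_n} | s != s0) (-1) ^+ s * \prod_i A i (s i)|
    <= n`!%:R * (M / L * D).
  apply: (le_trans (ler_norm_sum _ _ _)).
  apply: (@le_trans _ _ (\sum_(s : {perm 'I_n} | s != s0) M / L * D)).
    by apply: ler_sum => s ss0; rewrite termE le_term.
  rewrite sumr_const -[leLHS]mulr_natl ler_wpM2r //.
    by rewrite !mulr_ge0 // invr_ge0 ltW.
  by rewrite ler_nat -(card_Sn n) max_card.
have half : n`!%:R * (M / L * D) <= D / 2.
  rewrite !mulrA mulrC ler_wpM2l // ler_pdivrMr // ler_pdivlMl //.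
  by rewrite mulrA.
have : D <= `|\det A| + D / 2.
  rewrite /determinant (bigD1 s0) //=.
  have := le_trans rest half; rewrite /D -(termE s0) => resth.
  by rewrite -lerBlDr; apply: le_trans (lerB_normD _ _); rewrite lerB.
lra.
Qed.

Definition pos_semidef {R : realFieldType} {n} (G : 'M[R]_n) :=
  G^T = G /\ forall x : 'rV[R]_n, 0 <= (x *m G *m x^T) 0 0.

Lemma pos_semidef_diag_ge0 {R : realFieldType} {n} (G : 'M[R]_n) i :
  pos_semidef G -> 0 <= G i i.
Proof.
case=> _ /(_ (delta_mx 0 i)).
by rewrite -rowE trmx_delta -colE !mxE.
Qed.

(** Induction on the size: with pivot [a], [\det G = a * \det S] for the Schur
    complement [S], which is again positive semidefinite and has smaller diagonal
    entries than the corresponding block of [G].  If [a = 0], semidefiniteness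
    forces the first row to vanish. *)
Lemma det_pos_semidef_le {R : realFieldType} {n} (G : 'M[R]_n) :
  pos_semidef G -> \det G <= \prod_i G i i.
Proof.
elim: n G => [|n IH]; first by move=> G _; rewrite det_mx00 big_ord0.
rewrite -[n.+1]/(1 + n)%N => G psdG; have [symG posG] := psdG.
rewrite big_split_ord /= big_ord1.
pose a := G (lshift n 0) (lshift n 0).
pose u : 'rV[R]_n := ursubmx G.
have ulE : ulsubmx G = a%:M by rewrite [LHS]mx11_scalar !mxE.
have dlE : dlsubmx G = u^T by rewrite /u trmx_ursub symG.
have GE : G = block_mx a%:M u u^T (drsubmx G) by rewrite -ulE -dlE submxK.
rewrite -/a.
have prodE : \prod_i G (rshift 1 i) (rshift 1 i) = \prod_i (drsubmx G) i i.
  by apply: eq_bigr => i _; rewrite !mxE.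
rewrite prodE.
have a0 : 0 <= a by exact: pos_semidef_diag_ge0.
have form (t : R) (y : 'rV[R]_n) :
  row_mx t%:M y *m G *m (row_mx t%:M y)^T =
    (t *: a%:M + y *m u^T) *m t%:M + (t *: u + y *m drsubmx G) *m y^T.
  rewrite {1}GE mul_row_block tr_row_mx mul_row_col tr_scalar_mx.
  by rewrite !mul_scalar_mx.
have [az|anz] := eqVneq a 0.
  have u0 : u = 0.
    apply/rowP => j; rewrite [RHS]mxE; apply/eqP/negPn/negP => uj.
    pose b := drsubmx G j j.
    (* At (t, e_j) the form is 2 t u_j + b; this t makes it equal to -1. *)
    have := posG (row_mx (- (b + 1) / (2 * u 0 j))%:M (delta_mx 0 j)).
    rewrite form az scale_scalar_mx mulr0 raddf0 add0r mulmxDl -scalemxAl.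
    rewrite mul_mx_scalar trmx_delta -!rowE -!colE.
    have bE : G (rshift 1 j) (rshift 1 j) = b by rewrite /b !mxE.
    have uE : u 0 j = G (lshift n 0) (rshift 1 j) by rewrite /u !mxE.
    rewrite !mxE bE -uE.
    have -> : - (b + 1) / (2 * u 0 j) * u 0 j = - (b + 1) / 2 by field.
    lra.
  rewrite az mul0r GE az u0.
  rewrite -(det_tr (block_mx _ _ _ _)) tr_block_mx trmx0 trmx0 raddf0 det_lblock.
  by rewrite trmx0 det_mx11 !mxE mul0r.
pose S : 'M[R]_n := drsubmx G - a^-1 *: (u^T *m u).
have detE : \det G = a * \det S.
  have -> : G = block_mx 1%:M 0 (a^-1 *: u^T) 1%:M *m block_mx a%:M u 0 S.
    rewrite {1}GE mulmx_block !mul1mx !mul0mx !addr0 -!scalemxAl.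
    by rewrite mul_mx_scalar scalerA mulVf // scale1r /S addrC subrK.
  by rewrite det_mulmx det_lblock det_ublock !det1 !mul1r det_scalar1.
have symdr : (drsubmx G)^T = drsubmx G by rewrite trmx_drsub symG.
have psdS : pos_semidef S.
  split; first by rewrite /S linearB linearZ /= trmx_mul trmxK symdr.
  move=> y; pose t := - (a^-1 * (y *m u^T) 0 0).
  (* The chosen t minimises the form over its first coordinate. *)
  have := posG (row_mx t%:M y).
  have yuE : y *m u^T = ((y *m u^T) 0 0)%:M by exact: mx11_scalar.
  rewrite form scale_scalar_mx {1}yuE -raddfD /= {1}/t mulNr mulrAC mulVf //.
  rewrite mul1r addNr raddf0 mul0mx add0r.
  congr (_ <= fun_of_matrix (_ *m _) _ _).
  rewrite /S mulmxBr addrC -scalemxAr mulmxA yuE mul_scalar_mx scalerA.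
  by rewrite -scaleNr.
rewrite detE; apply: ler_wpM2l => //.
apply: (le_trans (IH S psdS)).
apply: ler_prod => i _; rewrite pos_semidef_diag_ge0 //=.
rewrite /S !mxE lerBlDr lerDl big_ord1 !mxE.
by rewrite mulr_ge0 ?invr_ge0 // -expr2 sqr_ge0.
Qed.

(** Hadamard's inequality, from the Gram matrix of the rows. *)
Lemma sqr_det_le_prod_row {R : realFieldType} {n} (A : 'M[R]_n) :
  (\det A) ^+ 2 <= \prod_i \sum_j A i j ^+ 2.
Proof.
have -> : \det A ^+ 2 = \det (A *m A^T) by rewrite det_mulmx det_tr expr2.
have psdAA : pos_semidef (A *m A^T).
  split; first by rewrite trmx_mul trmxK.
  move=> x; rewrite mulmxA -mulmxA -trmx_mul mxE.
  by apply: sumr_ge0 => j _; rewrite [X in _ * X]mxE -expr2 sqr_ge0.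
apply: (le_trans (det_pos_semidef_le _ psdAA)).
apply: ler_prod => i _; rewrite pos_semidef_diag_ge0 //= mxE.
by apply: ler_sum => j _; rewrite mxE expr2.
Qed.

(** * Products of independent random variables *)

Lemma measurable_preimageT {d d'} {T : measurableType d} {T' : measurableType d'}
    (X : T -> T') (B : set T') :
  measurable_fun setT X -> measurable B -> measurable (X @^-1` B).
Proof. by move=> mX mB; rewrite -[X in measurable X]setTI; exact: mX. Qed.

(** Monotone convergence in the presence of a fixed nonnegative weight. *)
Lemma cvg_integral_weighted {R : realType} {d} {T : measurableType d}
    (P : {measure set T -> \bar R}) (F : T -> R) (u_ : nat -> T -> R) (u : T -> R) :
  measurable_fun setT F -> (forall w, 0 <= F w) ->
  (forall n, measurable_fun setT (u_ n)) -> (forall n w, 0 <= u_ n w) ->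
  (forall w, {homo u_^~ w : m n / (m <= n)%N >-> m <= n}) ->
  (forall w, u_ n w @[n --> \oo] --> u w) ->
  (\int[P]_w (F w * u_ n w)%:E)%E @[n --> \oo] --> (\int[P]_w (F w * u w)%:E)%E.
Proof.
move=> mF F0 mu u0 ndu uu.
rewrite [X in _ --> X](_ : _ = (\int[P]_w limn (fun n => (F w * u_ n w)%:E))%E).
  apply: cvg_monotone_convergence => //.
  - by move=> n; apply/measurable_EFinP/measurable_funM.
  - by move=> n x _; rewrite lee_fin mulr_ge0.
  - by move=> x _ m n mn; rewrite lee_fin ler_wpM2l // ndu.
apply: eq_integral => w _; apply/esym/cvg_lim => //.
apply: cvg_EFin; first exact: nearW.
by apply: cvgM; [exact: cvg_cst|exact: uu].
Qed.

(** Weighted integrals that factor on indicators of [X] factor, by linearity, on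
    simple functions of [X]. *)
Lemma sfun_decouple {R : realType} {d d'} {T : measurableType d}
    {T' : measurableType d'} (P : {measure set T -> \bar R}) (X : T -> T')
    (F : T -> R) (C : \bar R) (h : {nnsfun T' >-> R}) :
  measurable_fun setT X -> measurable_fun setT F -> (forall w, 0 <= F w) ->
  (0 <= C)%E ->
  (forall B, measurable B ->
    \int[P]_w (F w * \1_B (X w))%:E = C * P (X @^-1` B))%E ->
  (\int[P]_w (F w * h (X w))%:E = C * \int[P]_w (h (X w))%:E)%E.
Proof.
move=> mX mF F0 C0 FB.
(* Values in the range of [h] are nonnegative; the absolute value makes every
   summand nonnegative without reference to the range. *)
have hE x : h x = \sum_(y <- fset_set (range h)) `|y| * \1_(h @^-1` [set y]) x.
  rewrite fimfunE fsbig_finite //=; apply: eq_bigr => y _; rewrite indicE.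
  have [/set_mem <-|] := boolP (x \in _); last by rewrite !mulr0.
  by rewrite ger0_norm.
have mh y : measurable (h @^-1` [set y]) by [].
have mhX y : measurable_fun setT (fun w => (\1_(h @^-1` [set y]) (X w) : R)).
  by apply: (measurableT_comp (measurable_indic _)).
have step (G : T -> R) : measurable_fun setT G -> (forall w, 0 <= G w) ->
    (\int[P]_w (G w * h (X w))%:E = \sum_(y <- fset_set (range h))
      `|y|%:E * \int[P]_w (G w * \1_(h @^-1` [set y]) (X w))%:E)%E.
  move=> mG G0.
  have mG1 y : measurable_fun setT (fun w => (G w * \1_(h @^-1` [set y]) (X w))%:E).
    by apply/measurable_EFinP; apply: measurable_funM.
  under eq_bigr => y _.
    rewrite -ge0_integralZl_EFin //; last first.
      by move=> w _; rewrite lee_fin mulr_ge0.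
    over.
  rewrite -ge0_integral_sum //.
  - apply: eq_integral => w _; rewrite hE mulr_sumr -sumEFin.
    by apply: eq_bigr => y _; rewrite -EFinM mulrCA.
  - by move=> y; apply: measurable_funeM.
  - by move=> y w _; rewrite mule_ge0 // lee_fin ?mulr_ge0.
rewrite step //.
have := step (cst 1); under eq_integral do rewrite mul1r.
move=> -> //.
rewrite ge0_sume_distrr; last first.
  move=> y _; rewrite mule_ge0 //; apply: integral_ge0 => w _.
  by rewrite lee_fin mulr_ge0.
apply: eq_bigr => y _; rewrite FB // muleCA; congr (_ * (_ * _))%E.
under eq_integral do rewrite mul1r.
have -> : (fun w => (\1_(h @^-1` [set y]) (X w))%:E : \bar R) =
  (fun w => (\1_(X @^-1` (h @^-1` [set y])) w)%:E) by [].
by rewrite integral_indic // ?setIT //; exact: measurable_preimageT.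
Qed.

(** The step that turns the definition of independence by events into a statement
    on functions: factorisation on indicators extends to all nonnegative
    measurable functions by monotone approximation.  The constant [C] may be
    infinite, as needed for heavy tails. *)
Lemma integral_decouple {R : realType} {d d'} {T : measurableType d}
    {T' : measurableType d'} (P : {measure set T -> \bar R}) (X : T -> T')
    (F : T -> R) (C : \bar R) :
  measurable_fun setT X -> measurable_fun setT F -> (forall w, 0 <= F w) ->
  (0 <= C)%E ->
  (forall B, measurable B ->
    \int[P]_w (F w * \1_B (X w))%:E = C * P (X @^-1` B))%E ->
  forall g : T' -> R, measurable_fun setT g -> (forall x, 0 <= g x) ->
  (\int[P]_w (F w * g (X w))%:E = C * \int[P]_w (g (X w))%:E)%E.
Proof.
move=> mX mF F0 C0 FB g mg g0.
have mEg : measurable_fun setT (EFin \o g) by exact/measurable_EFinP.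
pose g_ := nnsfun_approx measurableT mEg.
have mg_ n : measurable_fun setT (g_ n : T' -> R) by [].
have g_0 n x : 0 <= g_ n x by [].
have ndg x : {homo (fun n => g_ n x) : m n / (m <= n)%N >-> m <= n}.
  by move=> m n mn; exact/lefP/nd_nnsfun_approx.
have gg x : g_ n x @[n --> \oo] --> g x.
  have := @cvg_nnsfun_approx _ _ _ _ measurableT _ mEg
    (fun x _ => g0 x) x Logic.I.
  by move/fine_cvgP => [_].
have sfunE n : (\int[P]_w (F w * g_ n (X w))%:E =
    C * \int[P]_w (g_ n (X w))%:E)%E.
  exact: sfun_decouple.
have lhs : (\int[P]_w (F w * g_ n (X w))%:E @[n --> \oo] -->
    \int[P]_w (F w * g (X w))%:E)%E.
  apply: cvg_integral_weighted => //.
  by move=> n; exact: measurableT_comp.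
have rhs : (\int[P]_w (g_ n (X w))%:E @[n --> \oo] -->
    \int[P]_w (g (X w))%:E)%E.
  have one (f : T -> R) :
      (\int[P]_w (f w)%:E = \int[P]_w (cst 1 w * f w)%:E)%E.
    by apply: eq_integral => w _; rewrite mul1r.
  under eq_fun do rewrite one.
  rewrite one.
  apply: (@cvg_integral_weighted _ _ _ P (cst 1) (fun n w => g_ n (X w))) => //.
  by move=> n; exact: measurableT_comp.
set a := (\int[P]_w (g (X w))%:E)%E in rhs *.
(* Multiplication by an infinite constant is not continuous at 0, so a vanishing
   limit is treated separately: the approximating integrals then all vanish. *)
have Crhs : (C * \int[P]_w (g_ n (X w))%:E @[n --> \oo] --> C * a)%E.
  have [->|Cn0] := eqVneq C 0%E.
    by under eq_fun do rewrite mul0e; rewrite mul0e; exact: cvg_cst.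
  have [az|an0] := eqVneq a 0%E.
    have gn0 n : (\int[P]_w (g_ n (X w))%:E = 0)%E.
      apply/eqP; rewrite eq_le; apply/andP; split; last first.
        by apply: integral_ge0 => w _; rewrite lee_fin.
      rewrite -az; apply: ge0_le_integral => //.
      - by move=> w _; rewrite lee_fin.
      - by apply/measurable_EFinP; exact: measurableT_comp.
      - by apply/measurable_EFinP; exact: measurableT_comp.
      - move=> w _; rewrite lee_fin -(cvg_lim _ (gg (X w))) //.
        apply: nondecreasing_cvgn_le => //.
        exact: (cvgP _ (gg (X w))).
    by under eq_fun do rewrite gn0; rewrite az mule0; exact: cvg_cst.
  apply: cvgeM => //; last exact: cvg_cst.
  by rewrite mule_defE negb_or !negb_and Cn0 an0.
move: lhs; under eq_fun do rewrite sfunE; move=> lhs.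
exact: cvg_unique lhs Crhs.
Qed.

(** Starting from indicators, where the identity is the definition of
    independence, the factors are replaced by arbitrary functions one index at a
    time. *)
Lemma expectation_prod_indep {R : realType} {d} {T : measurableType d}
    (P : probability T R) (I : finType) (X : I -> T -> R) (g : I -> R -> R) :
  mutually_independent P X ->
  (forall i, measurable_fun setT (X i)) ->
  (forall i, measurable_fun setT (g i)) -> (forall i x, 0 <= g i x) ->
  (\int[P]_w (\prod_i g i (X i w))%:E = \prod_i \int[P]_w (g i (X i w))%:E)%E.
Proof.
move=> indX mX mg g0.
(* [S] is the set of indices whose factor is not required to be an indicator. *)
suff main (S : {set I}) (h : I -> R -> R) :
    (forall i, measurable_fun setT (h i)) -> (forall i x, 0 <= h i x) ->
    (forall i, i \notin S -> exists2 B, measurable B & h i = \1_B) ->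
    (\int[P]_w (\prod_i h i (X i w))%:E = \prod_i \int[P]_w (h i (X i w))%:E)%E.
  by apply: (main [set: I]%SET) => // i; rewrite inE.
have [n] := ubnP #|S|; elim: n => // n IH in S h * => Sn mh h0 hS.
have [S0|[i0 i0S]] := set_0Vmem S.
  have /choice[B BE] : forall i, exists B, measurable B /\ h i = \1_B.
    by move=> i; have [|B mB hB] := hS i; [rewrite S0 inE|exists B].
  have mB i : measurable (B i) := (BE i).1.
  have mXB i : measurable (X i @^-1` B i) by exact: measurable_preimageT.
  have factorE i : (\int[P]_w (h i (X i w))%:E = P (X i @^-1` B i))%E.
    rewrite (BE i).2; have := integral_indic P measurableT (mXB i).
    by rewrite setIT => <-.
  have prodE w : \prod_i h i (X i w) =
      \1_(\bigcap_(i in [set` [set: I]%SET]) X i @^-1` B i) w :> R.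
    rewrite indicE; have [/set_mem w_in|w_out] := boolP (w \in _).
      rewrite big1 // => i _; rewrite (BE i).2 indicE mem_set //.
      by apply: (w_in i); rewrite /= inE.
    have [i wi] : exists i, ~ B i (X i w).
      apply/existsNP => allB; move/negP: w_out; apply; apply/mem_set => i _.
      exact: allB.
    by rewrite (bigD1 i) //= (BE i).2 indicE memNset // mul0r.
  under eq_integral do rewrite prodE.
  rewrite integral_indic //; last first.
    by apply: fin_bigcap_measurable => //; exact: finite_finpred.
  rewrite setIT; apply: etrans (indX [set: I]%SET B mB) _.
  apply: eq_big => [i|i _]; first by rewrite inE.
  by rewrite factorE.
have mhX i : measurable_fun setT (h i \o X i) by exact: measurableT_comp.
rewrite (bigD1 i0) //= muleC.
under eq_integral do rewrite (bigD1 i0) //= mulrC.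
apply: (integral_decouple P (X i0)
  (fun w => \prod_(i | i != i0) h i (X i w))) => //.
- under eq_fun do rewrite -big_filter.
  by apply: measurable_prod => i _; exact: mhX.
- by move=> w; apply: prodr_ge0.
- by apply: prode_ge0 => i _; apply: integral_ge0 => w _; rewrite lee_fin.
move=> B mB.
pose h' i := if i == i0 then \1_B else h i.
have h'i0 : h' i0 = \1_B by rewrite /h' eqxx.
have h'n i : i != i0 -> h' i = h i by rewrite /h' => /negbTE ->.
have := IH (S :\ i0) h' _ _ _ _.
have -> : (\int[P]_w (\prod_i h' i (X i w))%:E =
    \int[P]_w (\prod_(i | i != i0) h i (X i w) * \1_B (X i0 w))%:E)%E.
  apply: eq_integral => w _; rewrite (bigD1 i0) //= h'i0 mulrC.
  by congr (_ * _)%:E; apply: eq_bigr => i /h'n ->.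
have -> : (\prod_i \int[P]_w (h' i (X i w))%:E =
    (\prod_(i | i != i0) \int[P]_w (h i (X i w))%:E) * P (X i0 @^-1` B))%E.
  rewrite (bigD1 i0) //= h'i0 muleC; congr (_ * _)%E.
    by apply: eq_bigr => i /h'n ->.
  have mXB := measurable_preimageT _ _ (mX i0) mB.
  by have := integral_indic P measurableT mXB; rewrite setIT => <-.
apply.
- by rewrite (cardsD1 i0) i0S in Sn.
- move=> i; rewrite /h'; case: eqVneq => // _; exact: measurable_indic.
- by move=> i x; rewrite /h'; case: eqVneq.
move=> i; rewrite !inE negb_and negbK => /predU1P[->|iS].
  by exists B.
rewrite h'n; first exact: hS.
by apply: contraNneq iS => ->.
Qed.

(** * Wigner entries indexed by the upper triangle *)

Definition sorted_pair {N} (i j : 'I_N) := if (i <= j)%N then (i, j) else (j, i).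

Lemma sorted_pair_le {N} (i j : 'I_N) :
  ((sorted_pair i j).1 <= (sorted_pair i j).2)%N.
Proof. by rewrite /sorted_pair; case: (leqP i j) => //= /ltnW. Qed.

Definition upper_pair {N} (i j : 'I_N) : upper_index N :=
  exist _ (sorted_pair i j) (sorted_pair_le i j).

(** The independent family in the definition of a Wigner matrix. *)
Definition upper_entry {R : realType} {N} {T : Type} (H : T -> 'M[R]_N)
    (k : upper_index N) : T -> R :=
  scaled_entry H (val k).1 (val k).2.

Lemma scaled_entry_upper {R : realType} {N} {T : Type} (H : T -> 'M[R]_N) i j w :
  (H w)^T = H w -> scaled_entry H i j w = upper_entry H (upper_pair i j) w.
Proof.
move=> symH; rewrite /upper_entry /= /sorted_pair; case: (leqP i j) => //= _.
by rewrite /scaled_entry -{1}symH mxE.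
Qed.

Section wigner_law.
Context {R : realType} {mu : probability (measurableTypeR R) R} {N : nat}
  {d : measure_display} {T : measurableType d} {P : probability T R}
  {H : T -> 'M[R]_N}.
Context (wH : wigner mu P H).

Lemma measurable_upper_entry k : measurable_fun setT (upper_entry H k).
Proof.
case: wH => _ mH _ _; rewrite /upper_entry /scaled_entry.
by apply: measurable_funM => //.
Qed.

Lemma wigner_expectation_prod (g : upper_index N -> R -> R) :
  (forall k, measurable_fun setT (g k)) -> (forall k x, 0 <= g k x) ->
  (\int[P]_w (\prod_k g k (upper_entry H k w))%:E =
   \prod_k \int[mu]_x (g k x)%:E)%E.
Proof.
move=> mg g0; case: wH => _ _ indH law.
rewrite expectation_prod_indep //; last exact: measurable_upper_entry.
apply: eq_bigr => k _.
(* [mu] lives on the copy [measurableTypeR R] of the Borel space [R], so the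
   entry is retyped before its law is identified with [mu]. *)
pose X : T -> measurableTypeR R := upper_entry H k.
have mX : measurable_fun setT X := measurable_upper_entry k.
have mgk : measurable_fun setT (g k : measurableTypeR R -> R) := mg k.
transitivity (\int[pushforward P X]_x (g k x)%:E)%E.
  rewrite ge0_integral_pushforward //; first exact/measurable_EFinP.
  by move=> x _; rewrite lee_fin.
apply: eq_measure_integral => A mA _; exact: law.
Qed.

Lemma measurable_det_moment (E p : R) :
  measurable_fun setT (fun w => `|\det (H w - E%:M)| `^ p).
Proof.
case: wH => _ mH _ _.
suff mdet : measurable_fun setT (fun w => \det (H w - E%:M)).
  have mnorm : measurable_fun setT (fun w => `|\det (H w - E%:M)|).
    exact: measurableT_comp.
  exact: (measurableT_comp (measurable_powR p) mnorm).
rewrite /determinant; apply: measurable_sum => s.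
apply: measurable_funM => //; apply: measurable_prod => i _.
under eq_fun do rewrite !mxE.
exact: measurable_funB.
Qed.

End wigner_law.

(** * Power means and row products *)

(** Jensen's inequality for the uniform weights, by induction on their number: the
    last term is split off with weight [1 / (n + 2)]. *)
Lemma powR_mean_le {R : realType} (p : R) n (x : 'I_n.+1 -> R) :
  1 <= p -> (forall i, 0 <= x i) ->
  (n.+1%:R^-1 * \sum_i x i) `^ p <= n.+1%:R^-1 * \sum_i x i `^ p.
Proof.
move=> p1; elim: n x => [|n IH] x x0; first by rewrite !big_ord1 !invr1 !mul1r.
rewrite big_ord_recr [in leRHS]big_ord_recr /=.
set y := \sum_i _; set z := \sum_i _.
have := IH (fun i => x (widen_ord (leqnSn n.+1) i)) (fun i => x0 _).
rewrite -/y -/z => {}IH.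
pose s : R := n.+1%:R^-1.
pose t : R := n.+2%:R^-1.
have t0 : 0 <= t by rewrite invr_ge0.
have t1 : t <= 1 by rewrite invf_le1 // ler1n.
have s0 : 0 <= s by rewrite invr_ge0.
have y0 : 0 <= y by apply: sumr_ge0.
have ts : (1 - t) * s = t.
  have sE : n.+1%:R * s = 1 by rewrite mulfV ?pnatr_eq0.
  have tE : (n.+1%:R + 1) * t = 1 by rewrite natr1 mulfV ?pnatr_eq0.
  have -> : 1 - t = n.+1%:R * t by lra.
  by rewrite mulrAC sE mul1r.
have nneg_in (r : R) : 0 <= r -> r \in (`[0, +oo[%classic : set R).
  by move=> r0; apply/mem_set; rewrite /= in_itv /= andbT.
have cvx : (t * x ord_max + (1 - t) * (s * y)) `^ p <=
    t * x ord_max `^ p + (1 - t) * (s * y) `^ p.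
  exact: (@convex_powR _ p p1 (Itv01 t0 t1) _ _
    (nneg_in _ (x0 _)) (nneg_in _ (mulr_ge0 s0 y0))).
rewrite mulrA ts in cvx.
rewrite -/t !mulrDr addrC; apply: (le_trans cvx).
by rewrite addrC lerD2r -{2}ts -mulrA ler_wpM2l // subr_ge0.
Qed.

Lemma powR_prod {R : realType} {I : finType} (x : I -> R) (p : R) :
  (forall i, 0 <= x i) -> (\prod_i x i) `^ p = \prod_i x i `^ p.
Proof.
move=> x0; suff [] : 0 <= \prod_i x i /\ (\prod_i x i) `^ p = \prod_i x i `^ p by [].
elim/big_ind2 : _ => [|a b a' b' [a0 <-] [a'0 <-]|i _] //.
- by rewrite powR1.
- by rewrite mulr_ge0 // powRM.
Qed.

Section row_means.
Context {R : realType} {mu : probability (measurableTypeR R) R} {n : nat}.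
Local Notation N := n.+1.
Context {d : measure_display} {T : measurableType d} {P : probability T R}
  {H : T -> 'M[R]_N}.
Context (wH : wigner mu P H).

(** Injectivity of [phi] guarantees that the entries in the product are
    independent; otherwise powers of [c] would appear. *)
Lemma wigner_expectation_inj (c : R -> R) (m : R) (phi : 'I_N -> upper_index N)
    (D : {set 'I_N}) :
  measurable_fun setT c -> (forall x, 0 <= c x) ->
  (\int[mu]_x (c x)%:E = m%:E)%E -> {in D &, injective phi} ->
  (\int[P]_w (\prod_(i in D) c (upper_entry H (phi i) w))%:E =
   (m ^+ #|D|)%:E)%E.
Proof.
move=> mc c0 cm phi_inj.
pose g k x := if k \in phi @: D then c x else 1.
have gE w : \prod_(i in D) c (upper_entry H (phi i) w) =
    \prod_k g k (upper_entry H k w).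
  by rewrite -(big_imset (fun k => c (upper_entry H k w)) phi_inj) big_mkcond.
under eq_integral do rewrite gE.
rewrite (wigner_expectation_prod wH); last 2 first.
- by move=> k; rewrite /g; case: (k \in _).
- by move=> k x; rewrite /g; case: ifP.
have intg k : (\int[mu]_x (g k x)%:E = (if k \in phi @: D then m else 1)%:E)%E.
  rewrite /g; case: (k \in _) => //.
  by rewrite (integral_cst mu measurableT) mul1e; exact: probability_setT.
under eq_bigr do rewrite intg.
by rewrite prodEFin -big_mkcond prodr_const card_in_imset.
Qed.

(** [c] at the scaled entries selected by [r], and the neutral value 1 elsewhere;
    [r] is meant to be [leq] (upper triangle) or [geq] (lower triangle). *)
Definition row_part (r : rel nat) (c : R -> R) (A : 'M[R]_N) (i j : 'I_N) : R :=
  if r i j then c (Num.sqrt N%:R * A i j) else 1.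

Definition row_means (r : rel nat) (c : R -> R) (A : 'M[R]_N) : R :=
  \prod_i (N%:R^-1 * \sum_j row_part r c A i j).

Lemma row_part_ge0 r c A i j : (forall x, 1 <= c x) -> 0 <= row_part r c A i j.
Proof.
by move=> c1; rewrite /row_part; case: ifP => // _; rewrite (le_trans _ (c1 _)).
Qed.

Lemma row_means_ge0 r c A : (forall x, 1 <= c x) -> 0 <= row_means r c A.
Proof.
move=> c1; apply: prodr_ge0 => i _; rewrite mulr_ge0 ?invr_ge0 //.
by apply: sumr_ge0 => j _; exact: row_part_ge0.
Qed.

Lemma measurable_row_means r c : measurable_fun setT c ->
  measurable_fun setT (fun w => row_means r c (H w)).
Proof.
case: wH => _ mH _ _ mc; apply: measurable_prod => i _.
apply: measurable_funM => //; apply: measurable_sum => j.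
rewrite /row_part; case: (r i j) => //.
by apply: (measurableT_comp mc); apply: measurable_funM.
Qed.

(** By Jensen the power goes inside the row means.  The product over rows of sums
    over columns then expands into the [N ^ N] maps [f] from rows to columns, with
    total weight 1; in the term of [f] the selected entries are distinct, so
    its expectation is at most [m ^ N]. *)
Lemma expectation_row_means_le (r : rel nat) (c : R -> R) (p m : R) :
  (forall f : {ffun 'I_N -> 'I_N},
    {in [set i : 'I_N | r i (f i)]%SET &, injective (fun i => upper_pair i (f i))}) ->
  1 <= p -> measurable_fun setT c -> (forall x, 1 <= c x) ->
  (\int[mu]_x (c x `^ p)%:E = m%:E)%E -> 1 <= m ->
  (\int[P]_w (row_means r c (H w) `^ p)%:E <= (m ^+ N)%:E)%E.
Proof.
move=> r_inj p1 mc c1 cm m1; have [symH _ _ _] := wH.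
have mcp : measurable_fun setT (fun x => c x `^ p).
  exact: (measurableT_comp (measurable_powR p) mc).
pose D (f : {ffun 'I_N -> 'I_N}) := [set i : 'I_N | r i (f i)]%SET.
pose F f w := \prod_(i in D f) c (upper_entry H (upper_pair i (f i)) w) `^ p.
have mF f : measurable_fun setT (F f).
  rewrite /F; under eq_fun do rewrite -big_filter.
  apply: measurable_prod => i _; apply: (measurableT_comp mcp).
  exact: measurable_upper_entry wH _.
have F0 f w : 0 <= F f w by apply: prodr_ge0 => i _; exact: powR_ge0.
have le_F w : row_means r c (H w) `^ p <= N%:R^-1 ^+ N * \sum_f F f w.
  have pos i j := row_part_ge0 r c (H w) i j c1.
  rewrite powR_prod; last first.
    by move=> i; rewrite mulr_ge0 ?invr_ge0 // sumr_ge0.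
  apply: (@le_trans _ _ (\prod_i (N%:R^-1 * \sum_j row_part r c (H w) i j `^ p))).
    by apply: ler_prod => i _; rewrite powR_ge0 /= powR_mean_le.
  rewrite big_split /= prodr_const card_ord ler_wpM2l ?exprn_ge0 ?invr_ge0 //.
  rewrite bigA_distr_bigA /= le_eqVlt; apply/orP; left; apply/eqP.
  apply: eq_bigr => f _; rewrite /F [RHS]big_mkcond /=.
  apply: eq_bigr => i _; rewrite inE /row_part; case: ifP => _; last by rewrite powR1.
  by rewrite -(scaled_entry_upper _ _ _ _ (symH w)).
apply: (@le_trans _ _ (\int[P]_w (N%:R^-1 ^+ N * \sum_f F f w)%:E)%E).
  apply: ge0_le_integral => //.
  - by move=> w _; rewrite lee_fin powR_ge0.
  - apply/measurable_EFinP; apply: (measurableT_comp (measurable_powR p)).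
    exact: measurable_row_means.
  - apply/measurable_EFinP; apply: measurable_funM => //.
    exact: measurable_sum.
  - by move=> w _; rewrite lee_fin.
under eq_integral do rewrite EFinM.
rewrite ge0_integralZl_EFin //; last 2 first.
- by move=> w _; rewrite lee_fin sumr_ge0.
- by apply/measurable_EFinP; exact: measurable_sum.
under eq_integral do rewrite -sumEFin.
rewrite ge0_integral_sum //; last 2 first.
- by move=> f; apply/measurable_EFinP.
- by move=> f w _; rewrite lee_fin.
have intF f : (\int[P]_w (F f w)%:E = (m ^+ #|D f|)%:E)%E.
  apply: (wigner_expectation_inj (fun x => c x `^ p)) => //.
  - by move=> x; exact: powR_ge0.
  - exact: r_inj.
under eq_bigr do rewrite intF.
rewrite sumEFin -EFinM lee_fin.
apply: (@le_trans _ _ (N%:R^-1 ^+ N * \sum_(f : {ffun 'I_N -> 'I_N}) m ^+ N)).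
  rewrite ler_wpM2l ?exprn_ge0 ?invr_ge0 //; apply: ler_sum => f _.
  by rewrite ler_weXn2l // -[leqRHS](card_ord N) max_card.
rewrite sumr_const card_ffun card_ord -[X in _ * X]mulr_natl mulrA natrX.
by rewrite exprVn mulVf ?mul1r // expf_neq0 // pnatr_eq0.
Qed.

End row_means.

(** After [(h - E)^2 <= 2 h^2 + 2 E^2], the quantity [quad_weight E x - 1] is the
    share of a scaled entry [x] in [N |row|^2], the shift of the diagonal entry
    being spread evenly over the [N] entries of its row. *)
Definition quad_weight {R : realType} (E x : R) : R :=
  1 + 2 * E ^+ 2 + 2 * x ^+ 2.

(** In Hadamard's bound the squared norm of each row is at most [a + b], where [a]
    and [b] are the means of [quad_weight E - 1] over the parts of the row right
    and left of the diagonal, which they share; [a + b <= (1 + a) (1 + b)]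
    separates the two triangles. *)
Lemma sqr_det_le_row_means {R : realType} n (A : 'M[R]_n.+1) (E : R) :
  \det (A - E%:M) ^+ 2 <=
    row_means leq (quad_weight E) A * row_means geq (quad_weight E) A.
Proof.
apply: (le_trans (sqr_det_le_prod_row _)).
rewrite -big_split /=; apply: ler_prod => i _.
rewrite sumr_ge0 /=; last by move=> j _; exact: sqr_ge0.
pose N : R := n.+1%:R.
have N0 : 0 < N by rewrite ltr0n.
pose u j := row_part leq (quad_weight E) A i j.
pose v j := row_part geq (quad_weight E) A i j.
pose x j := Num.sqrt N * A i j.
have x2 j : x j ^+ 2 = N * A i j ^+ 2 by rewrite exprMn sqr_sqrtr // ltW.
pose t j := 2 * E ^+ 2 + 2 * x j ^+ 2.
have t0 j : 0 <= t j by rewrite addr_ge0 // mulr_ge0 ?sqr_ge0.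
have uE j : u j = if (i <= j)%N then 1 + t j else 1.
  by rewrite /u /row_part /quad_weight /t addrA.
have vE j : v j = if (j <= i)%N then 1 + t j else 1.
  by rewrite /v /row_part /quad_weight /t addrA.
have meanE (y : 'I_n.+1 -> R) : N^-1 * \sum_j y j = 1 + N^-1 * \sum_j (y j - 1).
  rewrite sumrB sumr_const card_ord mulrBr -/N mulVf ?gt_eqF //.
  by rewrite addrC subrK.
have step1 : \sum_j (A - E%:M) i j ^+ 2 <= N^-1 * \sum_j t j.
  have -> : N^-1 * \sum_j t j =
      \sum_j (2 * A i j ^+ 2 + if j == i then 2 * E ^+ 2 else 0).
    rewrite !big_split /= -big_mkcond big_pred1_eq sumr_const card_ord mulrDr.
    rewrite -[X in _^-1 * X]mulr_natl mulKf ?gt_eqF // addrC mulr_sumr.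
    congr (_ + _); apply: eq_bigr => j _.
    by rewrite x2 mulrCA mulKf ?gt_eqF.
  apply: ler_sum => j _; rewrite !mxE eq_sym; case: eqP => _.
    by rewrite mulr1n; have := sqr_ge0 (A i j + E); nra.
  by rewrite mulr0n subr0 addr0; have := sqr_ge0 (A i j); lra.
have step2 : N^-1 * \sum_j t j <=
    N^-1 * \sum_j (u j - 1) + N^-1 * \sum_j (v j - 1).
  rewrite -mulrDr -big_split /= ler_wpM2l ?invr_ge0 ?(ltW N0) //.
  apply: ler_sum => j _; rewrite uE vE.
  have := t0 j; have := leq_total i j; move: (t j) => tj.
  by case: (i <= j)%N; case: (j <= i)%N => //= _ tj0; lra.
have a0 : 0 <= N^-1 * \sum_j (u j - 1).
  rewrite mulr_ge0 ?invr_ge0 ?(ltW N0) // sumr_ge0 // => j _.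
  by rewrite uE subr_ge0; case: ifP => // _; rewrite lerDl.
have b0 : 0 <= N^-1 * \sum_j (v j - 1).
  rewrite mulr_ge0 ?invr_ge0 ?(ltW N0) // sumr_ge0 // => j _.
  by rewrite vE subr_ge0; case: ifP => // _; rewrite lerDl.
rewrite (meanE u) (meanE v); apply: (le_trans step1); apply: (le_trans step2).
have := mulr_ge0 a0 b0.
by move: (N^-1 * _) (N^-1 * _) => a b; lra.
Qed.

(** An unordered pair [{i, f i}] with [i <= f i] determines [i] as its minimum,
    and one with [f i <= i] determines [i] as its maximum. *)
Lemma upper_pair_inj_leq {n} (f : {ffun 'I_n -> 'I_n}) :
  {in [set i : 'I_n | (i <= f i)%N]%SET &,
    injective (fun i => upper_pair i (f i))}.
Proof.
move=> i j; rewrite !inE => le_i le_j /(congr1 val) /=.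
by rewrite /sorted_pair le_i le_j => -[].
Qed.

Lemma upper_pair_inj_geq {n} (f : {ffun 'I_n -> 'I_n}) :
  {in [set i : 'I_n | (f i <= i)%N]%SET &,
    injective (fun i => upper_pair i (f i))}.
Proof.
have sorted (i : 'I_n) : (f i <= i)%N -> sorted_pair i (f i) = (f i, i).
  rewrite /sorted_pair leq_eqVlt => /predU1P[fi|fi]; last by rewrite leqNgt fi.
  by rewrite fi leqnn (val_inj fi).
move=> i j; rewrite !inE => /sorted fi /sorted fj /(congr1 val) /=.
by rewrite fi fj => -[].
Qed.

Lemma quad_weight_ge1 {R : realType} (E x : R) : 1 <= quad_weight E x.
Proof.
by rewrite /quad_weight; have := sqr_ge0 E; have := sqr_ge0 x; lra.
Qed.

Lemma measurable_quad_weight {R : realType} (E : R) :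
  measurable_fun setT (quad_weight E).
Proof.
apply: measurable_funD => //; exact: measurable_funM.
Qed.

(** * Exponential growth under a finite moment *)

(** The determinant is at most the larger of the two row products, whence its
    power is at most the sum of theirs.  A sum, unlike the product of the two row
    products, involves moments of order [2p] only. *)
Lemma det_moment_le {R : realType} {mu : probability (measurableTypeR R) R} {n}
    {d : measure_display} {T : measurableType d} {P : probability T R}
    {H : T -> 'M[R]_n.+1} (wH : wigner mu P H) (E p m : R) :
  1 <= p -> (\int[mu]_x (quad_weight E x `^ p)%:E = m%:E)%E -> 1 <= m ->
  (det_moment P H E p <= (2 * m ^+ n.+1)%:E)%E.
Proof.
move=> p1 cm m1; rewrite /det_moment unlock.
pose U r w := row_means r (quad_weight E) (H w) `^ p.
have mU r : measurable_fun setT (fun w => (U r w)%:E).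
  apply/measurable_EFinP; apply: (measurableT_comp (measurable_powR p)).
  exact: (measurable_row_means wH _ _ (measurable_quad_weight E)).
have U0 r w : (0 <= (U r w)%:E)%E by rewrite lee_fin powR_ge0.
have le_det w : `|\det (H w - E%:M)| `^ p <= U leq w + U geq w.
  pose a := row_means leq (quad_weight E) (H w).
  pose b := row_means geq (quad_weight E) (H w).
  have a0 : 0 <= a by apply: row_means_ge0; exact: quad_weight_ge1.
  have b0 : 0 <= b by apply: row_means_ge0; exact: quad_weight_ge1.
  have p0 : 0 <= p by exact: le_trans p1.
  have M0 : 0 <= Num.max a b by rewrite le_max a0.
  have det_le : `|\det (H w - E%:M)| <= Num.max a b.
    rewrite -(@ler_pXn2r _ 2) ?nnegrE // real_normK ?num_real //.
    apply: (le_trans (sqr_det_le_row_means _ _ _)).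
    by rewrite expr2 ler_pM // le_max lexx ?orbT.
  apply: (@le_trans _ _ (Num.max a b `^ p)).
    by apply: ge0_ler_powR; rewrite ?nnegrE.
  by rewrite /U -/a -/b; case: (leP a b) => _; rewrite ?lerDl ?lerDr powR_ge0.
apply: (@le_trans _ _ (\int[P]_w ((U leq w)%:E + (U geq w)%:E))%E).
  apply: ge0_le_integral => //.
  - apply/measurable_EFinP; exact: (measurable_det_moment wH).
  - exact: emeasurable_funD.
  - by move=> w _; rewrite -EFinD lee_fin.
rewrite ge0_integralD // mulr_natl mulr2n EFinD.
have mq := measurable_quad_weight E.
by apply: leeD; apply: (expectation_row_means_le wH) => //;
  [exact: upper_pair_inj_leq|exact: quad_weight_ge1
  |exact: upper_pair_inj_geq|exact: quad_weight_ge1].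
Qed.

Lemma ge0_integral_lt_pinfty_affine {R : realType} {d} {T : measurableType d}
    (P : probability T R) (f g : T -> R) (b c : R) :
  measurable_fun setT f -> measurable_fun setT g ->
  (forall x, 0 <= f x) -> (forall x, 0 <= g x) -> 0 <= b -> 0 <= c ->
  (forall x, f x <= b + c * g x) ->
  (\int[P]_x (g x)%:E < +oo -> \int[P]_x (f x)%:E < +oo)%E.
Proof.
move=> /measurable_EFinP mf /measurable_EFinP mg f0 g0 b0 c0 fg intg.
have mcg : measurable_fun setT (fun x => (c%:E * (g x)%:E)%E).
  exact: measurable_funeM.
apply: (@le_lt_trans _ _ (\int[P]_x (b%:E + c%:E * (g x)%:E))%E).
  apply: ge0_le_integral => //.
  - by move=> x _; rewrite lee_fin.
  - exact: emeasurable_funD.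
  - by move=> x _; rewrite -EFinM -EFinD lee_fin.
rewrite ge0_integralD //; last first.
  by move=> x _; rewrite mule_ge0 // lee_fin.
rewrite (integral_cst P measurableT) /= probability_setT mule1.
rewrite lte_add_pinfty ?ltry //.
rewrite ge0_integralZl_EFin //; last by move=> x _; rewrite lee_fin.
by rewrite lte_mul_pinfty // ?lee_fin.
Qed.

(** From [a + y <= 2 max(a, y)], the [p]-th power of the weight is dominated by a
    constant plus a multiple of [|x|^(2p)]. *)
Lemma quad_weight_moment {R : realType} (mu : probability (measurableTypeR R) R)
    (E p : R) : 1 <= p -> (abs_moment mu (2 * p) < +oo)%E ->
  exists2 m : R, 1 <= m & (\int[mu]_x (quad_weight E x `^ p)%:E = m%:E)%E.
Proof.
move=> p1 finm.
have p0 : 0 <= p by exact: le_trans p1.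
set I := (\int[mu]_x _)%E.
have mq : measurable_fun setT (fun x : measurableTypeR R => (quad_weight E x `^ p)%:E).
  apply/measurable_EFinP.
  exact: (measurableT_comp (measurable_powR p) (measurable_quad_weight E)).
have I1 : (1 <= I)%E.
  have <- : (\int[mu]_x 1%:E = 1)%E.
    by rewrite (integral_cst mu measurableT) mul1e; exact: probability_setT.
  apply: ge0_le_integral => // x _; rewrite lee_fin.
  apply: (@le_trans _ _ (1 `^ p)); first by rewrite powR1.
  by apply: ge0_ler_powR;
    rewrite ?nnegrE ?quad_weight_ge1 // (le_trans _ (quad_weight_ge1 E x)).
pose b : R := (2 * (1 + 2 * E ^+ 2)) `^ p.
have Ioo : (I < +oo)%E.
  apply: (ge0_integral_lt_pinfty_affine mu _ (fun x => `|x| `^ (2 * p))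
    b (4 `^ p)) finm.
  - exact: (measurableT_comp (measurable_powR p) (measurable_quad_weight E)).
  - exact: (measurableT_comp (measurable_powR (2 * p)) (@normr_measurable R setT)).
  - by move=> x; exact: powR_ge0.
  - by move=> x; exact: powR_ge0.
  - exact: powR_ge0.
  - exact: powR_ge0.
  move=> x; pose a : R := 1 + 2 * E ^+ 2.
  have a0 : 0 <= a by rewrite addr_ge0 // mulr_ge0 ?sqr_ge0.
  have -> : 4 `^ p * `|x| `^ (2 * p) = (2 * (2 * x ^+ 2)) `^ p.
    rewrite powRrM powR_mulrn // -powRM ?exprn_ge0 // real_normK ?num_real //.
    by rewrite mulrA -natrM.
  rewrite /b -/a.
  have x0 : 0 <= 2 * x ^+ 2 by rewrite mulr_ge0 ?sqr_ge0.
  have : quad_weight E x = a + 2 * x ^+ 2 by [].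
  move: (2 * x ^+ 2) x0 => y y0 ->.
  have [ay|/ltW ya] := leP a y.
    apply: (@le_trans _ _ ((2 * y) `^ p)); last by rewrite lerDr powR_ge0.
    by apply: ge0_ler_powR; rewrite ?nnegrE; lra.
  apply: (@le_trans _ _ ((2 * a) `^ p)); last by rewrite lerDl powR_ge0.
  by apply: ge0_ler_powR; rewrite ?nnegrE; lra.
exists (fine I).
  by rewrite -lee_fin fineK // ge0_fin_numE // (le_trans _ I1).
by rewrite fineK // ge0_fin_numE // (le_trans _ I1).
Qed.

Lemma limn_esup_lt_pinfty {R : realType} (u : nat -> \bar R) (b : R) :
  (forall n, (u n.+1 <= b%:E)%E) -> (limn_esup u < +oo)%E.
Proof.
move=> ub; apply: (@le_lt_trans _ _ b%:E); last exact: ltry.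
rewrite limn_esup_lim; apply: lime_le; first exact: is_cvg_esups.
near=> k; apply: ge_ereal_sup => _ [n /= kn <-].
have : (0 < n)%N by apply: leq_trans kn; near: k; exists 1%N.
by case: n kn.
Unshelve. all: by end_near. Qed.

(** * Heavy tails *)

Section tails.
Context {R : realType} (mu : probability (measurableTypeR R) R).

Definition outside (K : R) : set (measurableTypeR R) := [set x | K <= `|x|].
Definition inside (B : R) : set (measurableTypeR R) := [set x | `|x| <= B].

Lemma measurable_outside K : measurable (outside K).
Proof.
rewrite (_ : outside K = (Num.norm : R -> R) @^-1` `[K, +oo[%classic).
  exact: (measurable_preimageT _ _ (@normr_measurable R setT)).
by apply/seteqP; split => x /=; rewrite in_itv /= andbT.
Qed.

Lemma measurable_inside B : measurable (inside B).
Proof.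
rewrite (_ : inside B = (Num.norm : R -> R) @^-1` `]-oo, B]%classic).
  exact: (measurable_preimageT _ _ (@normr_measurable R setT)).
by apply/seteqP; split => x /=; rewrite in_itv.
Qed.

(** The intervals [[-n, n]] exhaust the line. *)
Lemma inside_gt0 : exists2 B, 0 <= B & (0 < mu (inside B))%E.
Proof.
apply: contrapT => no_B.
have in0 n : mu (inside n%:R) = 0%E.
  apply/eqP; rewrite eq_le measure_ge0 andbT leNgt.
  by apply/negP => gt0; apply: no_B; exists n%:R.
have cover : \bigcup_n inside n%:R = setT.
  apply/seteqP; split => // x _; exists (Num.bound `|x|) => //.
  by rewrite /inside /= ltW // archi_boundP.
have : mu (inside n%:R) @[n --> \oo] --> mu (\bigcup_n inside n%:R).
  apply: nondecreasing_cvg_mu.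
  - by move=> n; exact: measurable_inside.
  - by rewrite cover.
  - move=> m n mn; apply/subsetPset => x; rewrite /inside /= => /le_trans; apply.
    by rewrite ler_nat.
rewrite cover probability_setT; under eq_fun do rewrite in0.
move=> /cvg_lim => /(_ (@ereal_hausdorff R)); rewrite lim_cst // => /eqP.
by rewrite eqe eq_sym oner_eq0.
Qed.

Definition tail_power (K a p x : R) : R := \1_(outside K) x * (a * x ^+ 2) `^ p.

Lemma tail_power_ge0 K a p x : 0 <= tail_power K a p x.
Proof. by rewrite mulr_ge0 ?powR_ge0. Qed.

Lemma measurable_tail_power K a p : measurable_fun setT (tail_power K a p).
Proof.
apply: measurable_funM; first exact: (measurable_indic (measurable_outside K)).
apply: (measurableT_comp (measurable_powR p)); exact: measurable_funM.
Qed.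

(** Discarding the bounded part [|x| < K] costs at most [K^(2p)], so the tail
    carries the infinite moment. *)
Lemma tail_power_integral K a p : 1 <= p -> 0 <= K -> 0 < a ->
  abs_moment mu (2 * p) = +oo%E -> (\int[mu]_x (tail_power K a p x)%:E = +oo)%E.
Proof.
move=> p1 K0 a0 infm; apply/eqP; rewrite -leye_eq leNgt; apply/negP => fin.
have p0 : 0 <= p by exact: le_trans p1.
have : (abs_moment mu (2 * p) < +oo)%E; last by rewrite infm ltxx.
apply: (ge0_integral_lt_pinfty_affine mu _ (tail_power K a p)
  (K `^ (2 * p)) ((a^-1) `^ p)) fin.
- exact: (measurableT_comp (measurable_powR (2 * p)) (@normr_measurable R setT)).
- exact: measurable_tail_power.
- by move=> x; exact: powR_ge0.
- by move=> x; exact: tail_power_ge0.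
- exact: powR_ge0.
- exact: powR_ge0.
move=> x; have [xK|Kx] := ltP `|x| K.
  apply: (@le_trans _ _ (K `^ (2 * p))); last first.
    by rewrite lerDl mulr_ge0 ?powR_ge0 ?tail_power_ge0.
  by apply: ge0_ler_powR; rewrite ?nnegrE ?mulr_ge0 // ltW.
rewrite /tail_power indicE mem_set // mul1r -powRM ?invr_ge0 ?(ltW a0) //; last first.
  by rewrite mulr_ge0 ?sqr_ge0 // ltW.
rewrite mulKf ?gt_eqF // powRrM powR_mulrn // real_normK ?num_real //.
by rewrite lerDr powR_ge0.
Qed.

(** A law with an infinite moment has unbounded support. *)
Lemma outside_gt0 K p : 1 <= p -> 0 <= K -> abs_moment mu (2 * p) = +oo%E ->
  (0 < mu (outside K))%E.
Proof.
move=> p1 K0 infm; rewrite lt0e measure_ge0 andbT; apply/negP => /eqP mu0.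
have := tail_power_integral K 1 p p1 K0 ltr01 infm.
suff -> : (\int[mu]_x (tail_power K 1 p x)%:E = 0)%E by [].
rewrite (ge0_negligible_integral (measurable_outside K)) //; last 2 first.
- by apply/measurable_EFinP; exact: measurable_tail_power.
- by move=> x _; rewrite lee_fin tail_power_ge0.
apply: integral0_eq => x [_ nK].
by rewrite /tail_power indicE memNset // mul0r.
Qed.

End tails.

(** * Infinite moment *)

Section infinite_moment.
Context {R : realType} {mu : probability (measurableTypeR R) R} {n : nat}.
Local Notation N := n.+2.
Context {d : measure_display} {T : measurableType d} {P : probability T R}
  {H : T -> 'M[R]_N}.
Context (wH : wigner mu P H).

Let i0 : 'I_N := ord0.
Let i1 : 'I_N := lift ord0 ord0.
Let s0 : {perm 'I_N} := tperm i0 i1.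

(** The positions [(i, s0 i)]: the pair [{0, 1}] and the diagonal from 2 on. *)
Definition on_swap (k : upper_index N) : bool := (val k).2 == s0 (val k).1.

Lemma on_swap_upper_pair i j : on_swap (upper_pair i j) = (j == s0 i).
Proof.
rewrite /on_swap /= /sorted_pair; case: ifP => //= _.
by rewrite -(inj_eq (@perm_inj _ s0)) /s0 tpermK eq_sym.
Qed.

(** The threshold [K] is such that, after rescaling by [q = sqrt N] and shifting the
    diagonal by [E], the entries at [(i, s0 i)] are at least [2 N! M + 1], where
    [M = B + |E|] bounds the others.  All factors of the dominant term are then at
    least 1, and the two off-diagonal ones contribute [A i0 i1 ^ 2]. *)
Lemma sqr_le_det_of_swap (A : 'M[R]_N) (E B K : R) :
  let q := Num.sqrt N%:R in
  A^T = A -> 0 <= B -> q * (2 * N`!%:R * (B + `|E|) + 1 + `|E|) <= K ->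
  (forall i j, if j == s0 i then K <= `|q * A i j| else `|q * A i j| <= B) ->
  (2 * N%:R)^-1 * (q * A i0 i1) ^+ 2 <= `|\det (A - E%:M)|.
Proof.
move=> q symA B0 qK hA.
have q1 : 1 <= q by rewrite -(@sqrtr1 R) ler_sqrt // ler1n.
have q0 : 0 < q by exact: lt_le_trans q1.
pose M : R := B + `|E|.
pose L : R := 2 * N`!%:R * M + 1.
have M0 : 0 <= M by rewrite addr_ge0.
have L1 : 1 <= L by rewrite lerDr mulr_ge0 // mulr_ge0.
have entryE i j : (A - E%:M) i j = A i j - E *+ (i == j) by rewrite !mxE.
have normE (i j : 'I_N) : `|E *+ (i == j)| <= `|E|.
  by case: (i == j); rewrite ?mulr1n // mulr0n normr0.
have qA i j : `|q * A i j| = q * `|A i j| by rewrite normrM gtr0_norm.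
have big i : L <= `|(A - E%:M) i (s0 i)|.
  rewrite entryE; have := hA i (s0 i); rewrite eqxx qA => /(le_trans qK).
  rewrite ler_pM2l // => AL.
  have := lerB_normD (A i (s0 i)) (- (E *+ (i == s0 i))); rewrite normrN.
  by have := normE i (s0 i); rewrite /L /M; lra.
have small i j : j != s0 i -> `|(A - E%:M) i j| <= M.
  move=> /negbTE ji; rewrite entryE (le_trans (ler_normB _ _)) // lerD //.
  have := hA i j; rewrite ji qA; apply: le_trans.
  by rewrite ler_peMl.
have L0 : 0 < L by exact: lt_le_trans L1.
have := det_perm_dominant (A - E%:M) s0 M L M0 L0 _ big small.
rewrite /L lerDl ler01 => /(_ isT) detge.
have i10 : i1 != i0 by [].
rewrite invfM mulrAC -mulrA ler_pdivrMl //; apply: le_trans detge.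
rewrite (bigD1 i0) //= (bigD1 i1) //= /s0 tpermL tpermR !entryE.
have -> : A i1 i0 = A i0 i1 by rewrite -{1}symA mxE.
have Nn0 : (N%:R : R) != 0 by rewrite pnatr_eq0.
rewrite (negbTE i10) eq_sym (negbTE i10) mulr0n subr0.
rewrite exprMn sqr_sqrtr // mulrAC mulfV // mul1r.
rewrite -(real_normK (num_real _)) expr2 ler_wpM2l // ler_peMr //.
apply: (@le_trans _ _ (\prod_(i : 'I_N | (i != i0) && (i != i1)) 1)).
  by rewrite big1_eq.
by apply: ler_prod => i _; rewrite ler01 (le_trans L1).
Qed.

(** The determinant is minorised by a product of functions of single independent
    entries: indicators of the favourable ranges, times a power of the square of
    the entry [(0, 1)], which has infinite expectation. *)
Lemma det_moment_pinfty (E p : R) :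
  1 <= p -> abs_moment mu (2 * p) = +oo%E -> det_moment P H E p = +oo%E.
Proof.
move=> p1 infm; have [symH _ _ _] := wH.
have p0 : 0 <= p by exact: le_trans p1.
have [B B0 muB] := inside_gt0 mu.
pose q : R := Num.sqrt N%:R.
pose K : R := q * (2 * N`!%:R * (B + `|E|) + 1 + `|E|).
have K0 : 0 <= K.
  by rewrite mulr_ge0 ?sqrtr_ge0 // !addr_ge0 // mulr_ge0 ?addr_ge0 // mulr_ge0.
pose a : R := (2 * N%:R)^-1.
have a0 : 0 < a by rewrite invr_gt0 mulr_gt0 // ltr0n.
pose k01 := upper_pair i0 i1.
pose g (k : upper_index N) : R -> R :=
  if k == k01 then tail_power K a p
  else if on_swap k then \1_(outside K) else \1_(inside B).
have g0 k x : 0 <= g k x.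
  by rewrite /g; case: ifP => _; [exact: tail_power_ge0|case: ifP].
have mg k : measurable_fun setT (g k).
  rewrite /g; case: ifP => _; first exact: measurable_tail_power.
  by case: ifP => _; [exact: (measurable_indic (measurable_outside K))
                     |exact: (measurable_indic (measurable_inside B))].
have k01_swap : on_swap k01 by rewrite on_swap_upper_pair /s0 tpermL.
have g_le w : \prod_k g k (upper_entry H k w) <= `|\det (H w - E%:M)| `^ p.
  have [good|bad] := pselect (forall k,
      if on_swap k then outside K (upper_entry H k w)
      else inside B (upper_entry H k w)); last first.
    have [k bad_k] : exists k, g k (upper_entry H k w) = 0.
      move/existsNP : bad => [k bad_k]; exists k; rewrite /g.
      case: eqP => [kE|_]; move: bad_k.
        by rewrite kE k01_swap => nK; rewrite /tail_power indicE memNset ?mul0r.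
      by case: ifP => _ nK; rewrite indicE memNset.
    by rewrite (bigD1 k) //= bad_k mul0r powR_ge0.
  have gE k : k != k01 -> g k (upper_entry H k w) = 1.
    move=> /negbTE kE; rewrite /g kE; have := good k.
    by case: ifP => _ ?; rewrite indicE mem_set.
  rewrite (bigD1 k01) //= big1 ?mulr1; last by move=> k /gE.
  have := good k01; rewrite k01_swap => good01.
  rewrite /g eqxx /tail_power indicE mem_set // mul1r.
  have detle : a * upper_entry H k01 w ^+ 2 <= `|\det (H w - E%:M)|.
    rewrite -(scaled_entry_upper _ _ _ _ (symH w)).
    apply: (sqr_le_det_of_swap _ _ B K) => // i j.
    have := good (upper_pair i j).
    by rewrite on_swap_upper_pair -(scaled_entry_upper _ _ _ _ (symH w)); case: ifP.
  by apply: ge0_ler_powR; rewrite ?nnegrE // mulr_ge0 ?sqr_ge0 // ltW.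
apply/eqP; rewrite -leye_eq /det_moment unlock.
apply: (@le_trans _ _ (\int[P]_w (\prod_k g k (upper_entry H k w))%:E)%E); last first.
  apply: ge0_le_integral => //.
  - by move=> w _; rewrite lee_fin prodr_ge0.
  - apply/measurable_EFinP; apply: measurable_prod => k _.
    by apply: (measurableT_comp (mg k)); exact: measurable_upper_entry wH _.
  - by apply/measurable_EFinP; exact: (measurable_det_moment wH).
  - by move=> w _; rewrite lee_fin.
rewrite (wigner_expectation_prod wH) // (bigD1 k01) //= {1}/g eqxx.
rewrite tail_power_integral // gt0_mulye //.
apply: (big_ind (fun x => (0 < x)%E)) => // [x y|k kE]; first exact: mule_gt0.
rewrite /g (negbTE kE); case: ifP => _.
  rewrite (integral_indic mu measurableT (measurable_outside K)) setIT.
  exact: outside_gt0 p1 K0 infm.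
by rewrite (integral_indic mu measurableT (measurable_inside B)) setIT.
Qed.

End infinite_moment.

(** * Conclusion *)

Theorem theoremB1 (R : realType) (mu : probability (measurableTypeR R) R)
    (d : nat -> measure_display)
    (T : forall N : nat, measurableType (d N))
    (P : forall N : nat, probability (T N) R)
    (H : forall N : nat, T N -> 'M[R]_N)
    (hH : forall N : nat, wigner mu (P N) (H N))
    (p E : R) (hp : 1 <= p) :
  (abs_moment mu (2 * p) = +oo%E ->
     forall N : nat, (2 <= N)%N -> det_moment (P N) (H N) E p = +oo%E)
  /\
  ((abs_moment mu (2 * p) < +oo)%E ->
     (limn_esup (fun N : nat =>
        (N%:R^-1)%:E * lne (det_moment (P N) (H N) E p)) < +oo)%E).
Proof.
split=> [infm [//|[//|N]] _|finm].
  exact: (det_moment_pinfty (hH N.+2)).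
have [m m1 cm] := quad_weight_moment mu E p hp finm.
have m0 : 0 < m by exact: lt_le_trans m1.
apply: (limn_esup_lt_pinfty _ (ln 2 + ln m)) => N.
have le_moment := det_moment_le (hH N.+1) E p m hp cm m1.
have moment0 : (0 <= det_moment (P N.+1) (H N.+1) E p)%E.
  by rewrite /det_moment unlock; apply: integral_ge0 => w _; rewrite lee_fin powR_ge0.
have c0 : 0 < 2 * m ^+ N.+1 by rewrite mulr_gt0 // exprn_gt0.
have lnle : (lne (det_moment (P N.+1) (H N.+1) E p) <= (ln 2 + ln m *+ N.+1)%:E)%E.
  rewrite -lnXn // -lnM ?posrE ?exprn_gt0 // -lne_EFin // lee_lne //.
  - by rewrite in_itv /= moment0 leey.
  - by rewrite in_itv /= lee_fin ltW //= leey.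
apply: (@le_trans _ _ ((N.+1%:R^-1)%:E * (ln 2 + ln m *+ N.+1)%:E)%E).
  by apply: lee_wpmul2l => //; rewrite lee_fin invr_ge0.
rewrite -EFinM lee_fin mulrDr -[ln m *+ _]mulr_natl mulKf ?pnatr_eq0 // lerD2r.
by rewrite ler_piMl ?ln_ge0 ?ler1n // invf_le1 // ler1n.
Qed.
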